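(* Let $\sigma>0$ and $f\in G_\sigma$. Under the interpolation conditions described in the context, for any fixed $b_0>0$ and $0<\delta\le\delta_0$, the optimal value of $\beta$ in the interval $(0,\beta_0]$, where $$\beta_0=\frac{1}{3^{3/2}\cdot 2\rho\, n\, e^{4n\gamma_n+2}\, b_0^{3/2}\sqrt{\gamma_n}\,\sqrt{\delta}},$$ is the number minimizing $$MN(\beta):=\beta^{\frac{b_0}{4\gamma_n\delta}}\left\{\sup_{\xi\in R^n}e^{\frac{|\xi|^2}{4\beta}-\frac{|\xi|^3}{\sigma}}\right\}^{1/2},\qquad \beta\in(0,\beta_0].$$
   Context: Here $n\ge1$ is the dimension; $\gamma_1=2$ and $\gamma_n=2n(1+\gamma_{n-1})$ for $n\ge 2$; $\rho=\sqrt3/e$; $\alpha_n$ is the volume of the unit ball in $R^n$. $G_\sigma=\{f\in L^2(R^n):\int|\hat f(\xi)|^2e^{|\xi|^3/\sigma}d\xi<\infty\}$ with $\|f\|_{G_\sigma}=\left\{\int|\hat f(\xi)|^2e^{|\xi|^3/\sigma}d\xi\right\}^{1/2}$, where $\hat f$ denotes the Fourier transform of $f$. Interpolation conditions: $h(x)=e^{-\beta|x|^2}$, $x\in R^n$, $\beta>0$, is the Gaussian with shape parameter $\beta$. For $X=\{x_1,\dots,x_N\}\subset R^n$, the $h$ spline interpolating $f$ on $X$ is $s(x)=\sum_{j=1}^N c_jh(x-x_j)$ with $s(x_i)=f(x_i)$ for $i=1,\dots,N$. The point $x$ lies in a cube $E$ of side $b\ge b_0$, $0<\delta\le\delta_0$,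 and every subcube of $E$ of side $\delta$ contains a point of $X$. Here $$\delta_0=\min\left\{\frac{1}{(3^{3/4}\,e\,\sqrt{2\rho\beta}\,\sqrt n\,e^{2n\gamma_n})^4\,b_0^3\,\gamma_n},\ \delta_n\right\},$$ with $\delta_n=\frac{b_0}{2\gamma_n}$ if $n=1$ or $n=2$, $\delta_n=\frac{b_0}{2\gamma_n(n-1)}$ if $n>1$ is odd, and $\delta_n=\frac{b_0}{2\gamma_n(n-2)}$ if $n>2$ is even. Note that $\delta_0$ depends on $\beta$; the condition $\delta\le\delta_0$ is equivalent to $\delta\le\delta_n$ together with $\beta\le\beta_0$. Under these conditions the interpolation error satisfies $$|f(x)-s(x)|\le\Delta''(C\delta)^{c/\delta}(2\pi)^{-n}\left\{\sup_{\xi\in R^n}e^{\frac{|\xi|^2}{4\beta}-\frac{|\xi|^3}{\sigma}}\right\}^{1/2}\|f\|_{G_\sigma}\quad\text{for all }x\in E,$$ where $c=\frac{b_0}{8\gamma_n}$, $C=(3^{3/4}\,e\,\sqrt{2\rho\beta}\,\sqrt n\,e^{2n\gamma_n})^4\,b_0^3\,\gamma_n$, $\Delta''=\pi^{\frac{n-1}{4}}(n\alpha_n)^{1/2}2^{\frac{n+1}{4}}\rho^{\frac{n-2}{4}}$ for even $n$ and $\Delta''=\pi^{\frac n4}(n\alpha_n)^{1/2}\rho^{\frac{n-1}{4}}$ for odd $n$. ''Optimal'' means that the right-hand side of this error bound, as a function of $\beta$, is minimal. *)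

(* Defs.v *)
From HB Require Import structures.
From mathcomp Require Import all_boot all_order all_algebra.
From mathcomp Require Import all_classical all_reals all_analysis.
From mathcomp Require Import complex ring lra.

Set Implicit Arguments.
Unset Strict Implicit.
Unset Printing Implicit Defensive.

Import Order.TTheory GRing.Theory Num.Theory.
Import numFieldNormedType.Exports.

Local Open Scope classical_set_scope.
Local Open Scope ring_scope.

(* R^n is the measurable type of n-tuples with its product sigma-algebra (the
   Borel sigma-algebra).  Lebesgue measure on it is built by recursion on n, as
   the image of lebesgue_measure \x (Lebesgue measure on R^(n-1)) under the
   identification of R * R^(n-1) with R^n. *)
Notation Rn R n := (n.-tuple (measurableTypeR R)).

Section lebesgue_step.
Context {R : realType} (n : nat).
Variable mu : {sigma_finite_measure set (Rn R n) -> \bar R}.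

Definition tcons (p : measurableTypeR R * Rn R n) : Rn R n.+1 :=
  [tuple of p.1 :: p.2].

Lemma measurable_tcons : measurable_fun [set: _] tcons.
Proof. exact: (measurable_cons measurable_fst measurable_snd). Qed.

Definition lebesgue_step : set (Rn R n.+1) -> \bar R :=
  pushforward (lebesgue_measure \x mu)%E tcons.

Let step0 : lebesgue_step set0 = 0%E.
Proof. by rewrite /lebesgue_step /pushforward preimage_set0 measure0. Qed.

Let step_ge0 A : (0 <= lebesgue_step A)%E.
Proof. exact: (measure_ge0 (lebesgue_measure \x mu)%E). Qed.

Let step_sigma_additive : semi_sigma_additive lebesgue_step.
Proof.
move=> F mF tF mUF; rewrite /lebesgue_step /pushforward preimage_bigcup.
apply: measure_semi_sigma_additive.
- by move=> k; rewrite -[X in measurable X]setTI; exact: measurable_tcons.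
- apply/trivIsetP => /= i j _ _ ij; rewrite -preimage_setI.
  by move/trivIsetP : tF => /(_ _ _ _ _ ij) ->//; rewrite preimage_set0.
- by rewrite -preimage_bigcup -[X in measurable X]setTI; exact: measurable_tcons.
Qed.

HB.instance Definition _ := isMeasure.Build _ _ _ lebesgue_step
  step0 step_ge0 step_sigma_additive.

Let step_sigma_finite : sigma_finite setT lebesgue_step.
Proof.
have /sigma_finiteP[F [TF ndF Foo]] := sigma_finiteT (@lebesgue_measure R).
have /sigma_finiteP[G [TG ndG Goo]] := sigma_finiteT mu.
pose u (t : Rn R n.+1) : measurableTypeR R * Rn R n :=
  (tnth t ord0, [tuple of behead t]).
have mu_ : measurable_fun [set: Rn R n.+1] u.
  apply: measurable_fun_pair.
    exact: measurable_tnth.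
  exact: measurable_behead.
have uK : cancel tcons u.
  by move=> [x t]; congr pair; exact/val_inj.
exists (fun k => u @^-1` (F k `*` G k)).
  rewrite -preimage_bigcup [X in _ @^-1` X](_ : _ = setT) ?preimage_setT//.
  apply/seteqP; split=> // -[x y] _.
  have [k _ Fkx] : (\bigcup_i F i) x by rewrite -TF.
  have [l _ Gly] : (\bigcup_i G i) y by rewrite -TG.
  exists (maxn k l) => //; split.
    by move: x Fkx; exact/subsetPset/ndF/leq_maxl.
  by move: y Gly; exact/subsetPset/ndG/leq_maxr.
move=> k; have [mFk Fk] := Foo k; have [mGk Gk] := Goo k; split.
  by rewrite -[X in measurable X]setTI; apply: mu_ => //; exact: measurableX.
rewrite /lebesgue_step /pushforward (_ : tcons @^-1` _ = F k `*` G k).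
  by rewrite product_measure1E// lte_mul_pinfty// ge0_fin_numE.
by rewrite -comp_preimage (_ : u \o tcons = id)//; exact/funext.
Qed.

HB.instance Definition _ := Measure_isSigmaFinite.Build _ _ _ lebesgue_step
  step_sigma_finite.
End lebesgue_step.

Fixpoint lebesgue_n {R : realType} (n : nat) :
    {sigma_finite_measure set (Rn R n) -> \bar R} :=
  if n is m.+1 then lebesgue_step (@lebesgue_n R m)
  else dirac ([tuple] : Rn R 0).

Section euclidean_space.
Context {R : realType} {n : nat}.
Implicit Types x y : Rn R n.

Definition dotp x y : R := \sum_(i < n) tnth x i * tnth y i.

Definition enorm x : R := Num.sqrt (dotp x x).

Definition tsub x y : Rn R n := [tuple tnth x i - tnth y i | i < n].

(* Cubes are axis-parallel and closed; a is the corner with the smallest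
   coordinates and b the side. *)
Definition cube (a : Rn R n) (b : R) : set (Rn R n) :=
  [set x | forall i, tnth a i <= tnth x i <= tnth a i + b].

End euclidean_space.

Definition unit_ball_volume (R : realType) (n : nat) : R :=
  fine (lebesgue_n n [set x : Rn R n | enorm x <= 1]).

Section fourier_transform.
Context {R : realType} {n : nat}.
Implicit Types f g : Rn R n -> R[i].

Definition sqr_modulus (z : R[i]) : R := complex.Re z ^+ 2 + complex.Im z ^+ 2.

Definition L2fun f : Prop :=
  [/\ measurable_fun setT (fun x => complex.Re (f x)),
      measurable_fun setT (fun x => complex.Im (f x)) &
      (\int[lebesgue_n n]_x (sqr_modulus (f x))%:E < +oo)%E].

Definition cintegral (D : set (Rn R n)) (g : Rn R n -> R[i]) : R[i] :=
  ((\int[lebesgue_n n]_(x in D) complex.Re (g x)) +i*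
   (\int[lebesgue_n n]_(x in D) complex.Im (g x)))%C.

Definition truncated_fourier f (r : R) (xi : Rn R n) : R[i] :=
  cintegral [set x | enorm x <= r]
    (fun x => f x * (cos (dotp x xi) -i* sin (dotp x xi))%C).

(* The L2 (Plancherel) Fourier transform of f, without a normalising factor:
   the limit in L2, as r tends to infinity, of the integrals of
   f(x) exp(-i <x, xi>) over the balls of radius r. *)
Definition is_fourier f g : Prop :=
  L2fun g /\
  (\int[lebesgue_n n]_xi
      (sqr_modulus (g xi - truncated_fourier f r xi))%:E)%E
    @[r --> +oo] --> 0%E.

(* Every f in L2 has such a transform, unique up to a null set; the default
   value 0 is used only for f outside L2. *)
Definition fourier f : Rn R n -> R[i] := xget (cst 0) [set g | is_fourier f g].

Definition Gnorm2 (sigma : R) f : \bar R :=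
  (\int[lebesgue_n n]_xi
      (sqr_modulus (fourier f xi) * expR (enorm xi ^+ 3 / sigma))%:E)%E.

Definition Gspace (sigma : R) f : Prop :=
  L2fun f /\ (Gnorm2 sigma f < +oo)%E.

Definition Gnorm (sigma : R) f : R := Num.sqrt (fine (Gnorm2 sigma f)).

End fourier_transform.

Section interpolation.
Context {R : realType} {n N : nat}.

Definition gaussian (beta : R) (x : Rn R n) : R := expR (- beta * enorm x ^+ 2).

Definition hspline_interpolant (beta : R) (X : 'I_N -> Rn R n)
    (f s : Rn R n -> R[i]) : Prop :=
  (exists c : 'I_N -> R[i],
     s = fun x => \sum_(j < N) c j * ((gaussian beta (tsub x (X j)))%:C)%C) /\
  forall i, s (X i) = f (X i).

End interpolation.

(* The value 0 at n = 0 makes the recursion also give gamma_1 = 2. *)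
Fixpoint gamma_ (n : nat) : nat :=
  if n is m.+1 then (2 * n * (1 + gamma_ m))%N else 0%N.

Section constants.
Context {R : realType}.

Definition rho : R := Num.sqrt 3 / expR 1.

Definition Cconst (n : nat) (b0 beta : R) : R :=
  (3 `^ (3 / 4) * expR 1 * Num.sqrt (2 * rho * beta) * Num.sqrt n%:R
    * expR (2 * n%:R * (gamma_ n)%:R)) ^+ 4 * b0 ^+ 3 * (gamma_ n)%:R.

Definition delta_ (n : nat) (b0 : R) : R :=
  if (n <= 2)%N then b0 / (2 * (gamma_ n)%:R)
  else if odd n then b0 / (2 * (gamma_ n)%:R * (n%:R - 1))
  else b0 / (2 * (gamma_ n)%:R * (n%:R - 2)).

Definition delta0 (n : nat) (b0 beta : R) : R :=
  Num.min (1 / Cconst n b0 beta) (delta_ n b0).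

Definition beta0 (n : nat) (b0 delta : R) : R :=
  1 / (3 `^ (3 / 2) * (2 * rho) * n%:R
        * expR (4 * n%:R * (gamma_ n)%:R + 2) * b0 `^ (3 / 2)
        * Num.sqrt (gamma_ n)%:R * Num.sqrt delta).

(* For fixed delta <= delta_ n b0, the interval ]0, beta0 n b0 delta] is exactly
   the range of beta allowed by the beta-dependent condition
   delta <= delta0 n b0 beta. *)
Lemma le_delta0E (n : nat) (b0 delta beta : R) :
    (0 < n)%N -> 0 < b0 -> 0 < delta -> 0 < beta ->
  (delta <= delta0 n b0 beta) =
  (beta <= beta0 n b0 delta) && (delta <= delta_ n b0).
Proof.
move=> n0 b00 delta0_gt0 beta_gt0; rewrite /delta0 le_min; congr (_ && _).
have g0 : 0 < (gamma_ n)%:R :> R.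
  by rewrite ltr0n; case: n n0 => //= m _; rewrite !muln_gt0.
have nR0 : 0 < n%:R :> R by rewrite ltr0n.
have rho0 : 0 < rho by rewrite divr_gt0 ?sqrtr_gt0 ?expR_gt0.
have pow2 : forall x : R, 0 < x -> (x `^ (3 / 2)) ^+ 2 = x ^+ 3.
  move=> x x0.
  by rewrite -powR_mulrn ?powR_ge0// -powRrM mulfVK// powR_mulrn// ltW.
have sq4 : forall x : R, 0 <= x -> Num.sqrt x ^+ 4 = x ^+ 2.
  by move=> x x0; rewrite (exprM _ 2 2) sqr_sqrtr.
have three4 : (3 `^ (3 / 4)) ^+ 4 = 3 ^+ 3 :> R.
  by rewrite -powR_mulrn ?powR_ge0// -powRrM mulfVK// powR_mulrn.
rewrite /beta0; set B := (X in beta <= 1 / X).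
have B0 : 0 < B by rewrite !mulr_gt0 ?powR_gt0 ?expR_gt0 ?sqrtr_gt0.
set C := Cconst n b0 beta.
have C0 : 0 < C.
  rewrite /C /Cconst; apply: mulr_gt0 => //; apply: mulr_gt0; last exact: exprn_gt0.
  by rewrite exprn_gt0// !mulr_gt0 ?powR_gt0 ?expR_gt0 ?sqrtr_gt0 ?mulr_gt0.
have CE : C * delta = (beta * B) ^+ 2.
  have e4 : expR (4 * n%:R * (gamma_ n)%:R + 2) =
      expR (2 * n%:R * (gamma_ n)%:R) ^+ 2 * expR 1 ^+ 2 :> R.
    by rewrite -!expRM_natl -expRD; congr expR; ring.
  rewrite /C /Cconst /B; move: rho rho0 => r r0.
  rewrite !exprMn !sq4 ?three4 ?pow2 ?sqr_sqrtr ?e4//.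
  - ring.
  - exact: ltW.
  - by rewrite !mulr_ge0// ltW.
rewrite ler_pdivlMr// mulrC CE ler_pdivlMr// -[leRHS](expr1n _ 2).
by rewrite ler_pXn2r// nnegrE// ltW// mulr_gt0.
Qed.

Definition Delta'' (n : nat) : R :=
  if odd n then
    pi `^ (n%:R / 4) * (n%:R * unit_ball_volume R n) `^ (1 / 2)
      * rho `^ ((n%:R - 1) / 4)
  else
    pi `^ ((n%:R - 1) / 4) * (n%:R * unit_ball_volume R n) `^ (1 / 2)
      * 2 `^ ((n%:R + 1) / 4) * rho `^ ((n%:R - 2) / 4).

Definition sup_term (n : nat) (sigma beta : R) : R :=
  sup [set expR (enorm xi ^+ 2 / (4 * beta) - enorm xi ^+ 3 / sigma)
      | xi in [set: Rn R n]].

Definition error_bound (n : nat) (sigma b0 delta : R) (f : Rn R n -> R[i])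
    (beta : R) : R :=
  let c := b0 / (8 * (gamma_ n)%:R) in
  Delta'' n * (Cconst n b0 beta * delta) `^ (c / delta) * (2 * pi) ^- n
    * sup_term n sigma beta `^ (1 / 2) * Gnorm sigma f.

Definition MN (n : nat) (sigma b0 delta beta : R) : R :=
  beta `^ (b0 / (4 * (gamma_ n)%:R * delta))
    * sup_term n sigma beta `^ (1 / 2).

Definition minimizes_on (D : set R) (F : R -> R) (x : R) : Prop :=
  D x /\ forall y, D y -> F x <= F y.

End constants.

(* Main.v *)
Require Import Defs.
From mathcomp Require Import all_boot all_order all_algebra.
From mathcomp Require Import all_classical all_reals all_analysis.
From mathcomp Require Import measurable_realfun complex ring lra.

Import Order.TTheory GRing.Theory Num.Theory.
Import numFieldNormedType.Exports.

Local Open Scope classical_set_scope.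
Local Open Scope ring_scope.

(* The supremum is attained at |xi| = sigma / (6 beta), so that
   MN beta = exp (p ln beta + q / beta^3) with p = b0 / (4 gamma_n delta) and
   q = sigma^2 / 864.  In t = beta^-3 the exponent is strictly convex, with
   critical point beta^3 = 3 q / p; hence the minimum on ]0, beta0] is attained
   exactly at min ((3 q / p)^(1/3), beta0).  The error bound is MN times a factor
   independent of beta, which is positive when the norm of f is nonzero because
   the unit ball, lying between two cubes, has finite positive volume. *)

(** * Volumes of cubes and of the unit ball *)

Section euclidean_volume.
Context {R : realType}.

Lemma measurable_cube (n : nat) (a : Rn R n) (b : R) : measurable (cube a b).
Proof.
rewrite (_ : cube a b = \bigcap_(i : 'I_n)
    (fun x : Rn R n => tnth x i) @^-1` `[tnth a i, tnth a i + b]%classic); last first.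
  by apply/seteqP; split=> x /= abx i; have:= abx i; rewrite /= in_itv //; apply.
apply: fin_bigcap_measurable => // i _.
by rewrite -[X in measurable X]setTI; apply: measurable_tnth.
Qed.

(** Induction on the dimension: pulled back along [tcons], a cube is the product of an interval and
    a cube in the remaining coordinates. *)
Lemma lebesgue_cube (n : nat) (a : Rn R n) (b : R) : 0 <= b ->
  lebesgue_n n (cube a b) = (b ^+ n)%:E.
Proof.
move=> b0; elim: n a => [|n IHn] a.
  (* In dimension 0 every cube contains the only point, so its Dirac mass is 1 = [b ^+ 0]. *)
  by rewrite /= diracE mem_set// => -[].
transitivity ((lebesgue_measure \x lebesgue_n n)%E
    (`[thead a, thead a + b]%classic `*` cube [tuple of behead a] b)).
  rewrite /= /lebesgue_step /pushforward; congr (_ _).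
  have behead_lift i : tnth [tuple of behead a] i = tnth a (lift ord0 i).
    by case/tupleP: a => u t; rewrite tnthS !(tnth_nth u).
  apply/seteqP; split=> -[u x] /=.
    move=> ab; split; first by have := ab ord0; rewrite /= in_itv.
    move=> i; have := ab (lift ord0 i).
    by rewrite behead_lift tnthS.
  rewrite in_itv /= => -[abu abx] i.
  have [j ->|->] := unliftP ord0 i; last by [].
  by have := abx j; rewrite behead_lift tnthS.
rewrite product_measure1E//; last exact: measurable_cube.
rewrite IHn exprS EFinM; congr (_ * _)%E.
apply: etrans (lebesgue_measure_itv `[thead a, thead a + b]) _.
rewrite /= lte_fin ltrDl.
have [b_gt0|b_le0] := ltrP 0 b; first by rewrite -EFinB addrAC subrr add0r.
by congr EFin; apply/le_anti/andP.
Qed.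

Lemma dotp_ge0 (n : nat) (x : Rn R n) : 0 <= dotp x x.
Proof. by apply: sumr_ge0 => i _; apply: sqr_ge0. Qed.

Lemma enorm_le1 (n : nat) (x : Rn R n) : (enorm x <= 1) = (dotp x x <= 1).
Proof. by rewrite /enorm -[X in _ <= X]sqrtr1 ler_sqrt. Qed.

Lemma measurable_unit_ball (n : nat) :
  measurable [set x : Rn R n | enorm x <= 1].
Proof.
rewrite (_ : [set _ | _] = setT `&` [set x | dotp x x <= cst 1 x]); last first.
  by rewrite setTI; apply/seteqP; split=> x /=; rewrite enorm_le1.
apply: measurable_fun_le => //.
by apply: measurable_sum => i; apply: measurable_funM; apply: measurable_tnth.
Qed.

Lemma unit_ball_volume_gt0 (n : nat) : (0 < n)%N -> 0 < unit_ball_volume R n.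
Proof.
move=> n0; have nR0 : 0 < n%:R :> R by rewrite ltr0n.
pose B := [set x : Rn R n | enorm x <= 1].
(* The side 1/n works because x_i^2 <= x_i <= 1/n on this cube, and these n bounds add up to 1. *)
have Bsup : cube [tuple 0 | i < n] n%:R^-1 `<=` B.
  move=> x cx; rewrite /B /= enorm_le1.
  apply: (@le_trans _ _ (\sum_(i < n) n%:R^-1)); last first.
    by rewrite sumr_const card_ord -[X in X <= _]mulr_natl mulfV// gt_eqF.
  apply: ler_sum => i _; have := cx i; rewrite tnth_mktuple add0r => /andP[x0 xn].
  rewrite -[leRHS]mulr1; apply: ler_pM => //.
  by rewrite (le_trans xn)// invf_le1// ler1n.
have Bsub : B `<=` cube [tuple -1 | i < n] 2.
  move=> x; rewrite /B /= enorm_le1 => x1 i.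
  have xi1 : tnth x i ^+ 2 <= 1.
    apply: le_trans x1; rewrite /dotp (bigD1 i)//= expr2 lerDl.
    by apply: sumr_ge0 => j _; apply: sqr_ge0.
  have : `|tnth x i| <= 1 by rewrite -[leRHS]ger0_norm// -ler_sqr ?nnegrE// !real_normK ?num_real ?expr1n.
  by rewrite tnth_mktuple ler_norml (_ : -1 + 2 = 1 :> R)//; ring.
have mB : measurable B by exact: measurable_unit_ball.
have Bge : ((n%:R^-1 ^+ n)%:E <= lebesgue_n n B)%E.
  rewrite -(@lebesgue_cube n [tuple 0 | i < n]) ?invr_ge0//.
  by apply: le_measure; rewrite ?inE//; exact: measurable_cube.
have Ble : (lebesgue_n n B <= (2 ^+ n)%:E)%E.
  rewrite -(@lebesgue_cube n [tuple -1 | i < n])//.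
  by apply: le_measure; rewrite ?inE//; exact: measurable_cube.
(* [fine] sends +oo to 0, so positivity needs the finite upper bound as well as the lower one. *)
rewrite /unit_ball_volume fine_gt0//; apply/andP; split.
  by apply: lt_le_trans Bge; rewrite lte_fin exprn_gt0// invr_gt0.
by apply: le_lt_trans Ble _; rewrite ltry.
Qed.

End euclidean_volume.

(** * The supremum over frequencies and the closed form of [MN] *)

Section optimal_shape_parameter.
Context {R : realType}.

(** Lets the supremum over R^n be treated as one over radii r >= 0; in dimension 0 only r = 0 would
    occur. *)
Lemma exists_enorm (n : nat) (r : R) : (0 < n)%N -> 0 <= r ->
  exists x : Rn R n, enorm x = r.
Proof.
case: n => // n _ r0; exists [tuple if i == ord0 then r else 0 | i < n.+1].
rewrite /enorm /dotp (bigD1 ord0)//= tnth_mktuple eqxx big1 ?addr0.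
  by rewrite -expr2 sqrtr_sqr ger0_norm.
by move=> i /negPf i0; rewrite tnth_mktuple i0 mulr0.
Qed.

Lemma sup_termE (n : nat) (sigma beta : R) :
  (0 < n)%N -> 0 < sigma -> 0 < beta ->
  sup_term n sigma beta = expR (sigma ^+ 2 / (432 * beta ^+ 3)).
Proof.
move=> n0 s0 b0; rewrite /sup_term; set E := [set _ | _ in _].
have ubE : ubound E (expR (sigma ^+ 2 / (432 * beta ^+ 3))).
  move=> _ [xi _ <-]; rewrite ler_expR; have : 0 <= enorm xi := sqrtr_ge0 _.
  move: (enorm xi) => r r0; rewrite -subr_ge0.
  (* The gap to the maximum is a cubic in r with a double root at the maximiser sigma / (6 beta);
     the remaining linear factor is nonnegative for r >= 0. *)
  rewrite (_ : _ - _ = (6 * beta * r - sigma) ^+ 2 * (12 * beta * r + sigma)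
                         / (432 * beta ^+ 3 * sigma)).
    have b0' := ltW b0; have s0' := ltW s0.
    have b3 : 0 <= beta ^+ 3 by rewrite exprn_ge0.
    apply: (divr_ge0 _ (mulr_ge0 (mulr_ge0 (ler0n R 432) b3) s0')).
    apply: (mulr_ge0 (sqr_ge0 _)).
    exact: (addr_ge0 (mulr_ge0 (mulr_ge0 (ler0n R 12) b0') r0) s0').
  by field; rewrite !gt_eqF.
have maxE : E (expR (sigma ^+ 2 / (432 * beta ^+ 3))).
  have [|xi xiE] := @exists_enorm n (sigma / (6 * beta)) n0.
    by rewrite divr_ge0// ?mulr_ge0// ltW.
  exists xi => //; rewrite xiE; congr expR.
  by field; rewrite !gt_eqF.
apply/le_anti/andP; split; first by apply: ge_sup => //; eexists; exact: maxE.
by apply: ub_le_sup => //; eexists; exact: ubE.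
Qed.

Lemma MN_E (n : nat) (sigma b0 delta beta : R) :
  (0 < n)%N -> 0 < sigma -> 0 < beta ->
  MN n sigma b0 delta beta =
  expR (b0 / (4 * (gamma_ n)%:R * delta) * ln beta
        + sigma ^+ 2 / 864 / beta ^+ 3).
Proof.
move=> n0 s0 beta_gt0; rewrite /MN sup_termE// -expRM [X in X * _]/powR gt_eqF// -expRD.
(* The power 1/2 of the supremum turns 432 into 864. *)
by congr (expR (_ + _)); field; rewrite gt_eqF.
Qed.

(* In the variable t = beta^-3 the left-hand side is convex; by ln r < r - 1 at
   r = (m / beta)^3 it lies strictly above its tangent at beta = m. *)
Lemma log_plus_inverse_cube_lt (p q m beta : R) :
  0 < p -> 0 < m -> 0 < beta -> beta != m ->
  p * m ^+ 3 <= 3 * q -> p * m ^+ 3 = 3 * q \/ beta <= m ->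
  p * ln m + q / m ^+ 3 < p * ln beta + q / beta ^+ 3.
Proof.
move=> p0 m0 beta_gt0 neq pmq opt.
have r0 : 0 < m / beta by rewrite divr_gt0.
pose r := (m / beta) ^+ 3.
have r_gt0 : 0 < r by rewrite exprn_gt0.
have lnr : ln r = 3 * (ln m - ln beta).
  by rewrite /r lnXn// lnM ?posrE ?invr_gt0// lnV ?posrE// -[LHS]mulr_natl.
(* Strictness comes from [beta != m], which makes [ln r] nonzero. *)
have lnr_lt : ln r < r - 1.
  have lnr0 : ln r != 0.
    rewrite lnr mulf_neq0// subr_eq0; apply: contra neq => /eqP.
    by move/ln_inj => ->; rewrite ?posrE.
  by have := expR_gt1Dx lnr0; rewrite lnK ?posrE//; lra.
(* At the critical point the two coefficients agree; otherwise [beta <= m] gives r >= 1, and p / 3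
   <= q / m^3 suffices. *)
have tangent : p / 3 * (r - 1) <= q / m ^+ 3 * (r - 1).
  have [e|lt_beta] := opt.
    have -> : q = p * m ^+ 3 / 3 by rewrite e; field.
    by rewrite (_ : _ / m ^+ 3 = p / 3)//; field; rewrite gt_eqF.
  apply: ler_wpM2r.
    by rewrite subr_ge0 exprn_ege1// ler_pdivlMr// mul1r.
  by rewrite ler_pdivlMr ?exprn_gt0//; lra.
have rE : q / beta ^+ 3 = q / m ^+ 3 * r by rewrite /r; field; rewrite !gt_eqF.
(* Right side minus left side of the goal is q / m^3 * (r - 1) - p / 3 * ln r, positive by [tangent]
   and [lnr_lt]. *)
have := ltr_pM2l (divr_gt0 p0 (ltr0n R 3)) (ln r) (r - 1).
rewrite lnr_lt rE lnr => plt; lra.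
Qed.

(** * The strict minimum of [MN] up to [beta0] *)

Lemma gamma_gt0 (n : nat) : (0 < n)%N -> (0 < gamma_ n)%N.
Proof. by case: n => // n _; rewrite /= !muln_gt0. Qed.

Lemma beta0_gt0 (n : nat) (b0 delta : R) : (0 < n)%N -> 0 < b0 -> 0 < delta ->
  0 < beta0 n b0 delta.
Proof.
move=> n0 b00 d0; have g0 := gamma_gt0 n n0.
by rewrite divr_gt0// !mulr_gt0 ?powR_gt0 ?expR_gt0 ?sqrtr_gt0 ?ltr0n.
Qed.

Lemma MN_strict_minimum (n : nat) (sigma b0 delta : R) :
  (0 < n)%N -> 0 < sigma -> 0 < b0 -> 0 < delta ->
  exists2 m, 0 < m <= beta0 n b0 delta &
    forall beta, 0 < beta <= beta0 n b0 delta -> beta != m ->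
      MN n sigma b0 delta m < MN n sigma b0 delta beta.
Proof.
move=> n0 s0 b00 d0; have g0 := gamma_gt0 n n0.
have B0 := beta0_gt0 n b0 delta n0 b00 d0; move: (beta0 _ _ _) B0 => B B0.
pose p := b0 / (4 * (gamma_ n)%:R * delta); pose q := sigma ^+ 2 / 864.
have p0 : 0 < p by rewrite /p divr_gt0 ?mulr_gt0 ?ltr0n.
have q0 : 0 < q by rewrite /q pmulr_lgt0 ?invr_gt0 ?ltr0n ?exprn_gt0.
have pq0 : 0 < 3 * q / p by rewrite divr_gt0// mulr_gt0.
pose m0 := (3 * q / p) `^ 3^-1.
have m0_gt0 : 0 < m0 by rewrite powR_gt0.
have m0E : p * m0 ^+ 3 = 3 * q.
  rewrite /m0 -powR_mulrn ?powR_ge0// -powRrM mulVf// powRr1 ?ltW//.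
  by rewrite mulrC divfK// gt_eqF.
exists (Num.min m0 B); first by rewrite lt_min m0_gt0 B0 ge_min lexx orbT.
move=> beta /andP[beta_gt0 betaB] neq.
have min_gt0 : 0 < Num.min m0 B by rewrite lt_min m0_gt0.
rewrite !MN_E// ltr_expR; apply: log_plus_inverse_cube_lt => //.
  rewrite -m0E ler_pM2l// ler_pXn2r// ?nnegrE; try exact: ltW.
  by rewrite ge_min lexx.
(* Either the minimum is the critical point [m0], where [m0E] applies, or it is the endpoint [B],
   which bounds [beta]. *)
by case: (leP m0 B) => _; [left|right].
Qed.

(** * The error bound as a constant multiple of [MN] *)

Lemma rho_gt0 : 0 < rho :> R.
Proof. by rewrite divr_gt0 ?sqrtr_gt0 ?expR_gt0. Qed.

(** [beta] enters only through the fourth power of sqrt(2 rho beta), hence quadratically. *)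
Lemma CconstE (n : nat) (b0 beta : R) : 0 <= beta ->
  Cconst n b0 beta = Cconst n b0 1 * beta ^+ 2.
Proof.
move=> beta_ge0; have sq4 (x : R) : 0 <= x -> Num.sqrt x ^+ 4 = x ^+ 2.
  by move=> x0; rewrite (exprM _ 2 2) sqr_sqrtr.
have r0 := ltW rho_gt0.
rewrite /Cconst !exprMn !sq4 ?mulr_ge0//; ring.
Qed.

Lemma Cconst1_gt0 (n : nat) (b0 : R) : (0 < n)%N -> 0 < b0 ->
  0 < Cconst n b0 1.
Proof.
move=> n0 b00; have g0 := gamma_gt0 n n0; have r0 := rho_gt0.
by rewrite !mulr_gt0 ?exprn_gt0 ?mulr_gt0 ?powR_gt0 ?expR_gt0 ?sqrtr_gt0 ?mulr_gt0 ?ltr0n.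
Qed.

(** Collects what depends on neither [beta], [sigma] nor [f]; setting [beta] to 1 in [Cconst]
    removes its factor beta^2. *)
Definition error_factor (n : nat) (b0 delta : R) : R :=
  Delta'' n * (Cconst n b0 1 * delta) `^ (b0 / (8 * (gamma_ n)%:R) / delta)
    * (2 * pi) ^- n.

(** Raising beta^2 to the power c / delta with c = b0 / (8 gamma_n) doubles the exponent to b0 / (4
    gamma_n delta), the one in [MN]. *)
Lemma error_boundE (n : nat) (sigma b0 delta : R) (f : Rn R n -> R[i])
    (beta : R) :
  (0 < n)%N -> 0 < b0 -> 0 < delta -> 0 < beta ->
  error_bound sigma b0 delta f beta =
  error_factor n b0 delta * Gnorm sigma f * MN n sigma b0 delta beta.
Proof.
move=> n0 b00 d0 beta_gt0; have g0 := gamma_gt0 n n0.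
have Cd0 : 0 <= Cconst n b0 1 * delta by rewrite ltW// mulr_gt0// Cconst1_gt0.
rewrite /error_bound /error_factor /MN CconstE ?ltW// [_ * delta]mulrAC.
rewrite (powRM _ Cd0 (sqr_ge0 beta)) -(powR_mulrn 2 (ltW beta_gt0)) -powRrM.
rewrite (_ : 2%:R * (b0 / (8 * (gamma_ n)%:R) / delta)
             = b0 / (4 * (gamma_ n)%:R * delta)); first by ring.
by field; rewrite !gt_eqF ?ltr0n.
Qed.

Lemma error_factor_gt0 (n : nat) (b0 delta : R) :
  (0 < n)%N -> 0 < b0 -> 0 < delta -> 0 < error_factor n b0 delta.
Proof.
move=> n0 b00 d0; have v0 := @unit_ball_volume_gt0 R n n0.
have r0 := rho_gt0; have pi0 := pi_gt0 R.
have Cd0 := mulr_gt0 (Cconst1_gt0 n b0 n0 b00) d0.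
apply: mulr_gt0; last by rewrite invr_gt0 exprn_gt0// mulr_gt0.
apply: mulr_gt0; last exact: powR_gt0.
by rewrite /Delta''; case: ifP => _; rewrite !mulr_gt0 ?powR_gt0 ?mulr_gt0 ?ltr0n.
Qed.

Lemma unique_strict_minimizer (D : set R) (F : R -> R) (m : R) :
  D m -> (forall y, D y -> y != m -> F m < F y) ->
  unique (minimizes_on D F) m.
Proof.
move=> Dm Fm; split.
  by split=> // y Dy; have [->//|ym] := eqVneq y m; exact/ltW/Fm.
move=> y [Dy Fy]; apply/esym/eqP; apply: contraT => ym.
by have := lt_le_trans (Fm y Dy ym) (Fy m Dm); rewrite ltxx.
Qed.

End optimal_shape_parameter.

Theorem mainTheorem2 (R : realType) (n N : nat) (sigma b0 b delta : R)
    (f : Rn R n -> R[i]) (a : Rn R n) (X : 'I_N -> Rn R n)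
    (s : R -> Rn R n -> R[i]) :
  (1 <= n)%N -> 0 < sigma -> Gspace sigma f ->
  0 < b0 -> b0 <= b -> 0 < delta ->
  injective X ->
  (forall a', cube a' delta `<=` cube a b ->
     exists j, cube a' delta (X j)) ->
  (forall beta, 0 < beta <= beta0 n b0 delta ->
     delta <= delta0 n b0 beta /\ hspline_interpolant beta X f (s beta)) ->
  exists beta_opt : R,
    [/\ unique (minimizes_on `]0, beta0 n b0 delta] (MN n sigma b0 delta))
          beta_opt,
        minimizes_on `]0, beta0 n b0 delta] (error_bound sigma b0 delta f)
          beta_opt &
        Gnorm sigma f != 0 ->
        unique (minimizes_on `]0, beta0 n b0 delta]
                 (error_bound sigma b0 delta f)) beta_opt].
Proof.
move=> n1 s0 _ b00 _ d0 _ _ _.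
have [m mB MNm] := MN_strict_minimum n sigma b0 delta n1 s0 b00 d0.
have Dm : [set` `]0, beta0 n b0 delta]] m by rewrite /= in_itv.
have MNlt y : [set` `]0, beta0 n b0 delta]] y -> y != m ->
    MN n sigma b0 delta m < MN n sigma b0 delta y.
  by rewrite /= in_itv; exact: MNm.
have pos y : [set` `]0, beta0 n b0 delta]] y -> 0 < y.
  by rewrite /= in_itv => /andP[].
have K0 := error_factor_gt0 n b0 delta n1 b00 d0.
have G0 : 0 <= Gnorm sigma f := sqrtr_ge0 _.
have KE y : [set` `]0, beta0 n b0 delta]] y -> error_bound sigma b0 delta f y =
    error_factor n b0 delta * Gnorm sigma f * MN n sigma b0 delta y.
  by move=> Dy; exact: (error_boundE _ _ _ _ f _ n1 b00 d0 (pos y Dy)).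
have MNuniq := unique_strict_minimizer _ _ m Dm MNlt.
exists m; split; first exact: MNuniq.
  split; first exact: Dm.
  move=> y Dy; rewrite (KE m Dm) (KE y Dy).
  exact: (ler_wpM2l (mulr_ge0 (ltW K0) G0) (MNuniq.1.2 y Dy)).
(* With zero norm the bound vanishes on the whole interval and every point minimizes it; a nonzero
   norm makes the factor positive, so strict inequalities carry over from [MN]. *)
move=> Gneq0; have G_gt0 : 0 < Gnorm sigma f by rewrite lt_def Gneq0 G0.
apply: (unique_strict_minimizer _ _ m Dm) => y Dy ym.
by rewrite (KE m Dm) (KE y Dy) (ltr_pM2l (mulr_gt0 K0 G_gt0)); exact: MNlt.
Qed.
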